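(* Let $B(w)=\sum_{n\ge1}B_n\frac{w^n}{n!}\in\mathbb{C}[[w]]$ with $B_1\ne0$. Let $S_B:\mathbb{C}[[v]]\to\mathbb{C}[[v]]$ be the substitution map $S_B(g(v))=g(B(v))$, and let $\theta_B:\mathbb{C}[x]\to\mathbb{C}[x]$ be the umbral operator attached to $B(w)$, i.e. the unique linear map satisfying $\theta_{B}e^{xw}=e^{xB(w)}$. Then $S_{B}$ and $\theta_{B}$ are adjoint operators, i.e. $\langle S_B(A(v))|p(x)\rangle=\langle A(v)|\theta_B(p(x))\rangle$ for all $A(v)\in\mathbb{C}[[v]]$ and $p(x)\in\mathbb{C}[x]$.
   Context: For $A(v)=\sum_{n\ge0}A_n\frac{v^n}{n!}\in\mathbb{C}[[v]]$ and $f(x)=\sum_{n\ge0}f_nx^n\in\mathbb{C}[x]$, define $\langle A(v)|f(x)\rangle=\sum_{n\ge0}f_nA_n$. Linear operators on $\mathbb{C}[x]$ act on elements of $\mathbb{C}[x][[w]]$ (such as the formal exponentials $e^{xw}$ and $e^{xB(w)}=\sum_{n\ge0}x^nB(w)^n/n!$) coefficientwise in powers of $w$. *)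

(* Defs.v *)
From HB Require Import structures.
From mathcomp Require Import all_boot all_order all_algebra.
From mathcomp Require Export reals.
From mathcomp.real_closed Require Export complex.

Set Implicit Arguments.
Unset Strict Implicit.
Unset Printing Implicit Defensive.

Import Order.TTheory GRing.Theory Num.Theory.
Local Open Scope ring_scope.

(* A formal power series is the function giving its ordinary coefficients:
   a : fps K stands for \sum_n a n * v^n.  No convergence is involved, and the
   equality of series is the pointwise one. *)
Definition fps (K : Type) := nat -> K.

Section Fps.
Variable K : nzRingType.
Implicit Types a b g : fps K.

Definition fps_one : fps K := fun n => (n == 0)%:R.

Definition fps_mul a b : fps K := fun n => \sum_(i < n.+1) a i * b (n - i)%N.

Definition fps_exp b (n : nat) : fps K := iter n (fps_mul b) fps_one.

(* The sum over all n of a family of series in which the n-th series is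
   divisible by v^n: only the indices n <= m contribute to the coefficient of
   v^m.  It is only used on families of this kind; see fps_exp_low. *)
Definition fps_sum (u : nat -> fps K) : fps K :=
  fun m => \sum_(n < m.+1) u n m.

(* g(b(v)), for b without constant term. *)
Definition fps_comp g b : fps K := fps_sum (fun n m => g n * fps_exp b n m).

(* The coefficient A_n in the normalization A(v) = \sum_n A_n v^n / n!. *)
Definition egf_coef a (n : nat) : K := n`!%:R * a n.

Lemma fps_exp_low b n m : b 0%N = 0 -> (m < n)%N -> fps_exp b n m = 0.
Proof.
move=> b0; elim: n m => // n IHn m lt_mn; rewrite /fps_exp iterS /fps_mul.
apply: big1 => -[[|i] lt_im] _ /=; first by rewrite b0 mul0r.
rewrite -/(fps_exp b n) IHn ?mulr0 //.
by rewrite ltn_subLR // addSn ltnS (leq_trans _ (leq_addl i n)).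
Qed.

End Fps.

Section Umbral.
Variable K : fieldType.
Implicit Types (A B : fps K) (p : {poly K}).

Definition pairing A p : K := \sum_(n < size p) p`_n * egf_coef A n.

Definition subst_op B : fps K -> fps K := fun g => fps_comp g B.

(* A map on K[x] acting on K[x][[w]] coefficientwise in powers of w. *)
Definition coefwise (T : {poly K} -> {poly K}) (F : fps {poly K}) :
  fps {poly K} := fun n => T (F n).

(* e^{xw} *)
Definition exp_xw : fps {poly K} := fun n => n`!%:R^-1 *: 'X^n.

(* e^{xB(w)} = \sum_n x^n B(w)^n / n!, for B without constant term. *)
Definition exp_xB B : fps {poly K} :=
  fps_sum (fun n m => (fps_exp B n m / n`!%:R) *: 'X^n).

(* Linearity is not included: it is carried by the type of the map. *)
Definition is_umbral B (theta : {linear {poly K} -> {poly K}}) : Prop :=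
  coefwise theta exp_xw =1 exp_xB B.

Definition adjoint (S : fps K -> fps K) (T : {poly K} -> {poly K}) : Prop :=
  forall A p, pairing (S A) p = pairing A (T p).

End Umbral.

(* Main.v *)
From HB Require Import structures.
Require Import Defs.
From mathcomp Require Import all_boot all_order all_algebra.
Import GRing.Theory.
Local Open Scope ring_scope.

(** Both pairings are linear in the polynomial, so it suffices to compare them
    on the monomials.  The umbral operator sends [x^n] to [n!] times the
    coefficient of [w^n] in [e^{xB(w)}], and pairing [A] with that coefficient
    replaces [x^k / k!] by [A_k / k!], which gives the coefficient of [w^n] in
    [A(B(w))]. *)

Section LinearExtension.
Context {K : nzRingType} {V : lmodType K}.

(** Used with values in [{poly K}] to construct the umbral operator, and with values in [K^o] to
    make the pairing linear. *)
Definition lin_ext (e : nat -> V) (p : {poly K}) : V :=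
  \sum_(i < size p) p`_i *: e i.

Lemma lin_ext_widen e m (p : {poly K}) :
  (size p <= m)%N -> lin_ext e p = \sum_(i < m) p`_i *: e i.
Proof.
move=> le_pm; rewrite /lin_ext (big_ord_widen _ (fun i => p`_i *: e i) le_pm).
rewrite big_mkcond; apply: eq_bigr => i _.
by case: ltnP => // le_pi; rewrite nth_default ?scale0r.
Qed.

Lemma lin_ext_is_linear e : linear (lin_ext e).
Proof.
(* The three sums have different ranges; a common bound [m] allows a termwise comparison. *)
move=> a p q; pose m := maxn (size (a *: p + q)) (maxn (size p) (size q)).
rewrite !(@lin_ext_widen e m) ?leq_max ?leqnn ?orbT //.
rewrite scaler_sumr -big_split; apply: eq_bigr => i _.
by rewrite coefD coefZ scalerDl scalerA.
Qed.

HB.instance Definition _ e :=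
  GRing.isLinear.Build K {poly K} V *:%R (lin_ext e) (lin_ext_is_linear e).

Lemma lin_extXn e n : lin_ext e 'X^n = e n.
Proof.
rewrite /lin_ext size_polyXn big_ord_recr /= coefXn eqxx scale1r big1 ?add0r //.
by move=> i _; rewrite coefXn ltn_eqF ?scale0r.
Qed.

Lemma linear_lin_ext (f : {linear {poly K} -> V}) :
  f =1 lin_ext (fun n => f 'X^n).
Proof.
move=> p; rewrite -{1}[p]coefK poly_def linear_sum.
by apply: eq_bigr => i _; rewrite linearZ.
Qed.

End LinearExtension.

Section UmbralOperator.
Context {K : fieldType} (pcharK0 : [pchar K] =i pred0).
Implicit Types (A B : fps K) (theta : {linear {poly K} -> {poly K}}).

Let fact_neq0 n : n`!%:R != 0 :> K.
Proof. by rewrite ((pcharf0P K).1 pcharK0) -lt0n fact_gt0. Qed.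

(** The coefficient of w^n in e^{xw} is x^n / n!, and n! is invertible in characteristic 0. *)
Lemma is_umbralP B theta :
  is_umbral B theta <-> forall n, theta 'X^n = n`!%:R *: exp_xB B n.
Proof.
split=> H n; last by rewrite /coefwise /exp_xw linearZ /= H scalerK.
by rewrite -H /coefwise /exp_xw linearZ /= scalerA divff ?scale1r.
Qed.

Lemma pairing_lin_ext A (p : {poly K}) :
  pairing A p = lin_ext (egf_coef A : nat -> K^o) p.
Proof. by []. Qed.

Lemma pairing_exp_xB A B n : pairing A (exp_xB B n) = subst_op B A n.
Proof.
(* Both sides are truncated at k <= n, so they match term by term; the k! in [egf_coef] then cancels
   the 1/k! of the exponential. *)
rewrite pairing_lin_ext /exp_xB /fps_sum linear_sum; apply: eq_bigr => k _.
rewrite linearZ /= lin_extXn /egf_coef /GRing.scale /=.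
by rewrite mulrA divfK // mulrC.
Qed.

Lemma umbral_adjoint B theta : is_umbral B theta -> adjoint (subst_op B) theta.
Proof.
move=> /is_umbralP thetaX A p.
have ->: theta p = \sum_(n < size p) p`_n *: theta 'X^n.
  exact: linear_lin_ext.
rewrite [RHS]pairing_lin_ext linear_sum.
(* The factor n! coming from [thetaX] is the one that [egf_coef] puts on the coefficient of
   A(B(w)). *)
apply: eq_bigr => n _; rewrite linearZ /= thetaX linearZ /=.
by rewrite -pairing_lin_ext pairing_exp_xB.
Qed.

(** The values on the monomials are prescribed by [is_umbralP], and they determine a linear map. *)
Lemma umbral_exists_unique B :
  exists theta, is_umbral B theta /\
    forall theta', is_umbral B theta' -> theta' =1 theta.
Proof.
exists (lin_ext (fun n => n`!%:R *: exp_xB B n)); split.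
  by apply/is_umbralP => n /=; rewrite lin_extXn.
move=> theta' /is_umbralP thetaX p; rewrite linear_lin_ext.
by apply: eq_bigr => n _; rewrite thetaX.
Qed.

End UmbralOperator.

Theorem theorem4p4 (R : realType) (B : fps R[i])
    (hB0 : egf_coef B 0 = 0) (hB1 : egf_coef B 1 != 0) :
  (* the umbral operator attached to B exists and is unique *)
  (exists theta : {linear {poly R[i]} -> {poly R[i]}},
     is_umbral B theta /\
     forall theta' : {linear {poly R[i]} -> {poly R[i]}},
       is_umbral B theta' -> theta' =1 theta) /\
  (* it is adjoint to the substitution map *)
  (forall theta : {linear {poly R[i]} -> {poly R[i]}},
     is_umbral B theta -> adjoint (subst_op B) theta).
Proof.
have pchar0 : [pchar R[i]] =i pred0 by exact: Num.Theory.pchar_num.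
split; first exact: umbral_exists_unique.
by move=> theta; apply: umbral_adjoint.
Qed.
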